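(* Let $K$ be a field, let $m\ge2$ and $s\ge1$ be integers, and let $J$ be the cover ideal of the graph $K_m^s$ in the polynomial ring $R$ over $K$ with variables $x_j$ ($1\le j\le m$) and $x_{jl}$ ($1\le j\le m$, $1\le l\le s$). Consider the prime ideals $P_{j,l}=(x_j,x_{jl})$ for $1\le j\le m$, $1\le l\le s$, and $Q_{i,j}=(x_i,x_j)$ for $1\le i<j\le m$. Then for all $n\ge1$: (1) $v_{P_{j,l}}(J^{(n)})=mn+s-2$ for all $1\le j\le m$, $1\le l\le s$; (2) $v_{Q_{i,j}}(J^{(n)})=(m+s-1)n+s-1$ for all $1\le i<j\le m$; (3) $v(J^{(n)})=mn+s-2$.
   Context: $K_m^s$ is the graph with $m(s+1)$ vertices obtained from the complete graph $K_m$ by attaching $s$ pendant edges at each vertex of $K_m$: its vertices are $1,\ldots,m$ (the vertices of $K_m$) together with pendant vertices $jl$ for $1\le j\le m$, $1\le l\le s$; its edges are $(i,j)$ for $1\le i<j\le m$ and $(j,jl)$ for $1\le j\le m$, $1\le l\le s$. The variable $x_j$ corresponds to vertex $j$, and $x_{jl}$ to the vertex $jl$. The cover ideal of a finite simple graph $G$ is $J(G)=\bigcap_{(a,b)\in E(G)}\langle x_a,x_b\rangle$ in the standard graded polynomial ring $R$ over $K$ with one variable $x_a$ per vertex $a$. The $n$-th symbolic power is $J^{(n)}=\bigcap_{Q\in\operatorname{Ass}(R/J)}(J^nR_Q\cap R)$. For a homogeneous ideal $I$ of $R=\bigoplus_nR_n$ and $\mathfrak p\in\operatorname{Ass}(R/I)$,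 the local $v$-number is $v_{\mathfrak p}(I)=\min\{u:\text{there exists } f\in R_u\text{ with }\mathfrak p=(I:f)\}$, and the $v$-number is $v(I)=\min\{v_{\mathfrak p}(I):\mathfrak p\in\operatorname{Ass}(R/I)\}$. *)

(* Defs.v *)
From HB Require Import structures.
From mathcomp Require Import all_boot all_order all_algebra.
From mathcomp Require Export mpoly.

Set Implicit Arguments.
Unset Strict Implicit.
Unset Printing Implicit Defensive.

Import GRing.Theory.
Local Open Scope ring_scope.

(* Ideals are Prop-valued predicates: those of ring_quotient are boolean,
   hence decidable, and always proper. *)

(* The finite sums of elements a * s with a in A and s in S. *)
Definition combinations (B : comNzRingType) (A S : B -> Prop) (x : B) : Prop :=
  exists (k : nat) (a t : 'I_k -> B),
    [/\ forall i, A (a i), forall i, S (t i) & x = \sum_(i < k) a i * t i].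

Section Ideals.
Variable B : comNzRingType.
Implicit Types (I p : B -> Prop).

Definition ideal_gen (S : B -> Prop) : B -> Prop :=
  combinations (fun _ => True) S.

Definition is_ideal I : Prop :=
  [/\ I 0, forall x y, I x -> I y -> I (x + y)
    & forall a x, I x -> I (a * x)].

Definition is_prime_ideal p : Prop :=
  [/\ is_ideal p, ~ p 1 & forall x y, p (x * y) -> p x \/ p y].

Definition ideal_pow I (n : nat) : B -> Prop :=
  ideal_gen (fun x => exists f : 'I_n -> B,
    (forall i, I (f i)) /\ x = \prod_(i < n) f i).

Definition colon I (f : B) : B -> Prop := fun g => I (g * f).

(* p \in Ass(B / I) *)
Definition associated_prime I p : Prop :=
  is_prime_ideal p /\ exists f : B, forall g, p g <-> colon I f g.

End Ideals.

Section SymbolicPower.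
Variable B : idomainType.
Implicit Types (I q : B -> Prop).

(* The local ring B_q, as a subset of the fraction field. *)
Definition localization q (x : {fraction B}) : Prop :=
  exists a b : B, ~ q b /\ x = tofrac a / tofrac b.

(* The ideal I B_q. *)
Definition extension I q : {fraction B} -> Prop :=
  combinations (localization q) (fun x => exists2 a : B, I a & x = tofrac a).

(* I B_q \cap B *)
Definition contraction I q : B -> Prop := fun g => extension I q (tofrac g).

Definition symbolic_power I (n : nat) : B -> Prop :=
  fun g => forall q, associated_prime I q -> contraction (ideal_pow I n) q g.

End SymbolicPower.

Definition is_min (S : nat -> Prop) (k : nat) : Prop :=
  S k /\ forall u, S u -> (k <= u)%N.

Section VNumber.
Variables (K : fieldType) (N : nat).
Implicit Types (I p : {mpoly K[N]} -> Prop).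

(* p \in Ass(R / I) and v_p(I) = k *)
Definition is_local_v_number I p (k : nat) : Prop :=
  associated_prime I p /\
  is_min (fun u => exists2 f : {mpoly K[N]},
            f \is u.-homog & forall g, p g <-> colon I f g) k.

(* v(I) = k *)
Definition is_v_number I (k : nat) : Prop :=
  is_min (fun u => exists p, is_local_v_number I p u) k.

End VNumber.

Record sgraph := SGraph {
  vertex :> finType;
  adj : rel vertex;
  adj_sym : ssrbool.symmetric adj;
  adj_irrefl : irreflexive adj
}.

Section CoverIdeal.
Variables (K : fieldType) (G : sgraph).

Local Notation R := {mpoly K[#|G|]}.

Definition var (a : G) : R := 'X_(enum_rank a).

(* The ideal <x_a, x_b>. *)
Definition edge_prime (a b : G) : R -> Prop :=
  ideal_gen (fun x : R => x = var a \/ x = var b).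

Definition cover_ideal : R -> Prop :=
  fun f => forall a b : G, adj a b -> edge_prime a b f.

End CoverIdeal.

Arguments var : clear implicits.
Arguments var K {G} a.
Arguments edge_prime : clear implicits.
Arguments edge_prime K {G} a b _.
Arguments cover_ideal : clear implicits.

Section WhiskeredComplete.
Variables m s : nat.

(* inl j is the vertex j of K_m, and inr (j, l) the pendant vertex jl. *)
Definition Kms_adj : rel ('I_m + 'I_m * 'I_s)%type := fun a b =>
  match a, b with
  | inl i, inl j => i != j
  | inl i, inr (j, _) => i == j
  | inr (j, _), inl i => i == j
  | inr _, inr _ => false
  end.

Lemma Kms_adj_sym : ssrbool.symmetric Kms_adj.
Proof. by move=> [i|[i l]] [j|[j k]] //=; rewrite eq_sym. Qed.

Lemma Kms_adj_irrefl : irreflexive Kms_adj.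
Proof. by move=> [i|[i l]] //=; rewrite eqxx. Qed.

Definition Kms : sgraph := SGraph Kms_adj_sym Kms_adj_irrefl.

Definition core (j : 'I_m) : Kms := inl j.
Definition pendant (j : 'I_m) (l : 'I_s) : Kms := inr (j, l).

End WhiskeredComplete.

Arguments core {m} s j.

(* Main.v *)
(* For a graph G, the associated primes of the symbolic powers J^(n) of its
   cover ideal are the primes <x_a, x_b> of its edges, and J^(n) is the
   intersection of the <x_a, x_b>^n; hence a monomial x^mu lies in J^(n) iff
   mu_a + mu_b >= n for every edge ab. If (J^(n) : f) = <x_a, x_b>, some
   monomial x^mu of f is outside J^(n) while x_a x^mu and x_b x^mu are inside,
   which forces mu_a + mu_b = n - 1 and mu_c + mu_d >= n on every other edge.
   Conversely (J^(n) : x^mu) = <x_a, x_b> for every such critical mu, so the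
   local v-number is the least degree of a critical exponent. For K_m^s it is
   bounded below by splitting the degree into the m blocks made of a vertex of
   K_m and its pendant vertices. *)

Require Import Defs.
From mathcomp Require Import all_boot all_order all_algebra.
From mathcomp Require Import zify ring.

Set Implicit Arguments.
Unset Strict Implicit.
Unset Printing Implicit Defensive.

(** * Generated ideals, powers and prime ideals *)

Section Ideals.
Import GRing.Theory.
Local Open Scope ring_scope.
Variable B : comNzRingType.
Implicit Types (I p S : B -> Prop).

Lemma ideal_genS S x : S x -> ideal_gen S x.
Proof.
move=> Sx; exists 1%N, (fun _ => 1), (fun _ => x); split=> //.
by rewrite big_ord1 mul1r.
Qed.

Lemma ideal_gen_ideal S : is_ideal (ideal_gen S).
Proof.
split.
- by exists 0%N, (fun _ => 0), (fun _ => 0); split=> [|[]|] //; rewrite big_ord0.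
- move=> _ _ [k1 [a1 [t1 [_ St1 ->]]]] [k2 [a2 [t2 [_ St2 ->]]]].
  exists (k1 + k2)%N.
  exists (fun i => match split i with inl j => a1 j | inr j => a2 j end).
  exists (fun i => match split i with inl j => t1 j | inr j => t2 j end).
  split=> // [i|]; first by case: (split i).
  rewrite big_split_ord /=; congr (_ + _); apply: eq_bigr => i _.
    case: splitP => j /= E; last by have := ltn_ord i; lia.
    by have -> : i = j by apply: ord_inj.
  case: splitP => j /= E; first by have := ltn_ord j; lia.
  by have -> : i = j by apply: ord_inj; lia.
- move=> b _ [k [a [t [_ St ->]]]]; exists k, (fun i => b * a i), t; split=> //.
  by rewrite mulr_sumr; apply: eq_bigr => i _; rewrite mulrA.
Qed.

Lemma ideal_gen_min S I x :
  is_ideal I -> (forall y, S y -> I y) -> ideal_gen S x -> I x.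
Proof.
move=> [I0 ID IM] SI [k [a [t [_ St ->]]]].
by elim/big_ind: _ => // i _; apply/IM/SI.
Qed.

Lemma ideal_sum I (T : eqType) (r : seq T) (F : T -> B) :
  is_ideal I -> (forall i, i \in r -> I (F i)) -> I (\sum_(i <- r) F i).
Proof.
move=> [I0 ID _] IF; rewrite big_seq.
by elim/big_ind: _.
Qed.

Lemma prime_prod p (T : finType) (P : pred T) (F : T -> B) :
  is_prime_ideal p -> (forall i, P i -> ~ p (F i)) -> ~ p (\prod_(i | P i) F i).
Proof.
move=> [_ p1 pM] pF; elim/big_ind: _ => //.
by move=> x y npx npy /pM [].
Qed.

Lemma prime_exp p n x : is_prime_ideal p -> ~ p x -> ~ p (x ^+ n).
Proof.
move=> [_ p1 pM] npx; elim: n => [|n IHn]; first by rewrite expr0.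
by rewrite exprS => /pM [].
Qed.

Lemma ideal_powS I n x y :
  I x -> ideal_pow I n y -> ideal_pow I n.+1 (x * y).
Proof.
move=> Ix; have [i0 iD iM] :=
  ideal_gen_ideal (fun x => exists f : 'I_n.+1 -> B,
    (forall i, I (f i)) /\ x = \prod_(i < n.+1) f i).
(* The [y] with [x * y] in the power of exponent [n.+1] form an ideal, so it suffices to treat
   products of [n] elements of [I]. *)
apply: (@ideal_gen_min _ (fun y => ideal_pow I n.+1 (x * y))).
  split; first by rewrite mulr0; apply: i0.
  - by move=> u v Iu Iv; rewrite mulrDr; apply: iD.
  - by move=> a u Iu; rewrite mulrCA; apply: iM.
move=> _ [f [If ->]]; apply: ideal_genS.
exists (fun i => if unlift ord0 i is Some j then f j else x); split.
  by move=> i; case: (unlift _ _).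
rewrite big_ord_recl unlift_none; congr (_ * _).
by apply: eq_bigr => i _; rewrite liftK.
Qed.

End Ideals.

(** * Contraction from the localization at a prime *)

Section Contraction.
Import GRing.Theory.
Local Open Scope ring_scope.
Variable B : idomainType.
Implicit Types (I q : B -> Prop).

(** Clearing denominators: those of a finite sum multiply to a common one, which stays outside [q]
    because [q] is prime. *)
Lemma contractionP I q g : is_ideal I -> is_prime_ideal q ->
  contraction I q g <-> exists2 h, ~ q h & I (h * g).
Proof.
move=> [I0 ID IM] q_prime; have [[q0 _ _] nq1 qM] := q_prime.
have nz h : ~ q h -> tofrac h != 0.
  by move=> nqh; rewrite tofrac_eq0; apply/eqP => h0; case: nqh; rewrite h0.
split=> [[k [x [t [xq tI gE]]]]|[h nqh Ihg]].
  suff [h [c [nqh Ic hE]]] : exists h c,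
      [/\ ~ q h, I c & tofrac h * (\sum_(i < k) x i * t i) = tofrac c].
    exists h => //; suff -> : h * g = c by [].
    by apply/eqP; rewrite -tofrac_eq tofracM gE hE.
  elim/big_ind: _ => [|u v [h1 [c1 [nq1' I1 E1]]] [h2 [c2 [nq2 I2 E2]]]|i _].
  - by exists 1, 0; split=> //; rewrite mulr0 tofrac0.
  - exists (h1 * h2), (h2 * c1 + h1 * c2); split; first by case/qM.
      by apply: ID; apply: IM.
    by rewrite mulrDr tofracD !tofracM -E1 -E2 !mulrA (mulrC (tofrac h2)).
  - have [a [b [nqb ->]]] := xq i; have [c Ic ->] := tI i.
    exists b, (a * c); split=> //; first exact: IM.
    by rewrite tofracM !mulrA (mulrC (tofrac b)) mulfK // nz.
exists 1%N, (fun _ => tofrac 1 / tofrac h), (fun _ => tofrac (h * g)); split.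
- by move=> _; exists 1, h.
- by move=> _; exists (h * g).
- by rewrite big_ord1 tofrac1 div1r tofracM mulKf // nz.
Qed.

End Contraction.

(** * Order of vanishing along an edge *)

Section EdgeOrder.
Import GRing.Theory.
Local Open Scope ring_scope.
Variables (K : fieldType) (G : sgraph).
Local Notation R := {mpoly K[#|G|]}.
Local Notation monom := 'X_{1..#|G|}.
Implicit Types (f g h : R) (mu nu : monom) (a b c d : G).

Definition expo mu a : nat := mu (enum_rank a).

Definition edge_deg a b mu : nat := (expo mu a + expo mu b)%N.

(* Membership in the power <x_a, x_b>^n. *)
Definition edge_vanish a b n : pred R :=
  fun f => all (fun mu => n <= edge_deg a b mu)%N (msupp f).

Lemma expoD mu nu a : expo (mu + nu) a = (expo mu a + expo nu a)%N.
Proof. exact: mnmDE. Qed.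

Lemma expoU a b : expo U_(enum_rank a)%MM b = (a == b).
Proof. by rewrite /expo mnm1E (inj_eq enum_rank_inj). Qed.

Lemma edge_degD a b mu nu :
  edge_deg a b (mu + nu) = (edge_deg a b mu + edge_deg a b nu)%N.
Proof. by rewrite /edge_deg !expoD addnACA. Qed.

Lemma edge_degC a b mu : edge_deg a b mu = edge_deg b a mu.
Proof. exact: addnC. Qed.

Lemma edge_vanishP a b n f :
  reflect (forall mu, mu \in msupp f -> (n <= edge_deg a b mu)%N)
          (edge_vanish a b n f).
Proof. exact: allP. Qed.

Lemma edge_vanishX a b n mu :
  edge_vanish a b n 'X_[mu] = (n <= edge_deg a b mu)%N.
Proof. by rewrite /edge_vanish msuppX /= andbT. Qed.

Lemma edge_vanishM a b n k f g : edge_vanish a b n f -> edge_vanish a b k g ->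
  edge_vanish a b (n + k) (f * g).
Proof.
move=> /edge_vanishP Vf /edge_vanishP Vg; apply/edge_vanishP => mu.
by case/msuppM_le/allpairsP=> -[u v] [/= /Vf Hu /Vg Hv ->]; rewrite edge_degD leq_add.
Qed.

Lemma edge_vanish_ideal a b n : is_ideal (edge_vanish a b n).
Proof.
split; first by rewrite /edge_vanish -mpolyC0 msupp0.
- move=> f g /edge_vanishP Vf /edge_vanishP Vg; apply/edge_vanishP => mu.
  by move=> /msuppD_le; rewrite mem_cat => /orP [/Vf|/Vg].
- by move=> f g; apply: (@edge_vanishM a b 0 n); apply/edge_vanishP.
Qed.

Lemma edge_vanish_leq a b n k f :
  (k <= n)%N -> edge_vanish a b n f -> edge_vanish a b k f.
Proof.
by move=> kn /edge_vanishP Vf; apply/edge_vanishP => mu /Vf; apply: leq_trans.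
Qed.

(** Serves to split off the lowest form of a polynomial, [P] selecting the monomials of least degree
    in the two variables of an edge. *)
Lemma mpoly_partition (P : pred monom) f : exists f1 f2, [/\ f = f1 + f2,
  {in msupp f1, forall mu, P mu && (mu \in msupp f)} &
  {in msupp f2, forall mu, ~~ P mu && (mu \in msupp f)}].
Proof.
have supp (Q : pred monom) mu :
    mu \in msupp (\sum_(nu <- msupp f | Q nu) f@_nu *: 'X_[nu]) ->
    Q mu && (mu \in msupp f).
  move=> /msupp_sum_le /flattenP [s /mapP [nu]]; rewrite mem_filter.
  case/andP=> Qnu fnu -> /msuppZ_le; rewrite msuppX inE => /eqP ->.
  by rewrite Qnu fnu.
exists (\sum_(nu <- msupp f | P nu) f@_nu *: 'X_[nu]).
exists (\sum_(nu <- msupp f | ~~ P nu) f@_nu *: 'X_[nu]).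
split; [|exact: supp|exact: supp].
by rewrite {1}[f]mpolyE (bigID P).
Qed.

(* The lowest forms of f and g multiply to the lowest form of f * g. *)
Lemma edge_vanish_primary a b n f g :
  edge_vanish a b n (f * g) -> ~~ edge_vanish a b 1 g -> edge_vanish a b n f.
Proof.
move=> + ng; elim: n => [|n IHn] Vfg; first exact/edge_vanishP.
have /edge_vanishP Vf := IHn (edge_vanish_leq (leqnSn n) Vfg).
have [f0 [f1 [fE Hf0 Hf1]]] := mpoly_partition (fun mu => edge_deg a b mu == n) f.
have [g0 [g1 [gE Hg0 Hg1]]] := mpoly_partition (fun mu => edge_deg a b mu == 0%N) g.
have Vf1 : edge_vanish a b n.+1 f1.
  by apply/edge_vanishP => mu /Hf1 /andP [nn /Vf]; rewrite ltn_neqAle eq_sym nn.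
have Vg1 : edge_vanish a b 1 g1.
  by apply/edge_vanishP => mu /Hg1 /andP [nn _]; rewrite lt0n.
have g0_neq0 : g0 != 0.
  by apply: contra ng => /eqP g00; rewrite gE g00 add0r.
have Vf0 : edge_vanish a b n f0.
  by apply/edge_vanishP => mu /Hf0 /andP [/eqP ->].
have [_ VD VM] := edge_vanish_ideal a b n.+1.
have Vf0g0 : edge_vanish a b n.+1 (f0 * g0).
  (* Every product other than [f0 * g0] has a factor of higher order, so the lowest product inherits
     the order of [f * g]. *)
  have -> : f0 * g0 = f * g + (- 1) * (g * f1 + f0 * g1).
    by rewrite [f in RHS]fE [g]gE; ring.
  apply: (VD) => //; apply: (VM); apply: VD; first exact: VM.
  by rewrite -addn1; apply: edge_vanishM.
suff f00 : f0 == 0 by rewrite fE (eqP f00) add0r.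
(* The monomials of [f0 * g0] have edge degree exactly [n], yet at least [n.+1]; the product is
   therefore zero, in a domain. *)
suff: f0 * g0 == 0 by rewrite mulf_eq0 (negPf g0_neq0) orbF.
apply: contraT; rewrite -msupp_eq0; case E : msupp => [//|mu s] _.
have mu_in : mu \in msupp (f0 * g0) by rewrite E mem_head.
have := edge_vanishP _ _ _ _ Vf0g0 _ mu_in.
case/msuppM_le/allpairsP: mu_in => -[u v] [/= /Hf0 Hu /Hg0 Hv ->].
case/andP: Hu => /eqP Hu _; case/andP: Hv => /eqP Hv _.
by rewrite edge_degD Hu Hv addn0 ltnn.
Qed.

Lemma mpolyX_decomp mu a : (0 < expo mu a)%N ->
  exists2 nu, 'X_[mu] = var K a * 'X_[nu] & mu = (U_(enum_rank a) + nu)%MM.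
Proof.
move=> mua; have muE : mu = (U_(enum_rank a) + (mu - U_(enum_rank a)))%MM.
  rewrite addmC submK //; apply/mnm_lepP => i; rewrite mnm1E.
  by case: eqP => // <-.
exists (mu - U_(enum_rank a))%MM => //.
by rewrite {1}muE mpolyXD.
Qed.

Lemma var_vanish a b : edge_vanish a b 1 (var K a).
Proof. by rewrite edge_vanishX /edge_deg expoU eqxx. Qed.

Lemma edge_vanishC a b n f : edge_vanish a b n f = edge_vanish b a n f.
Proof. by rewrite /edge_vanish; apply: eq_all => mu; rewrite edge_degC. Qed.

Lemma var_vanishr a b : edge_vanish a b 1 (var K b).
Proof. by rewrite edge_vanishC var_vanish. Qed.

(** * Edge primes *)

Lemma edge_primeE a b f : edge_prime K a b f <-> edge_vanish a b 1 f.
Proof.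
split; first apply: (ideal_gen_min (I := fun g => edge_vanish a b 1 g)).
- exact: edge_vanish_ideal.
- by move=> _ [] ->; rewrite (var_vanish, var_vanishr).
move=> /edge_vanishP Vf; rewrite [f]mpolyE.
have [i0 iD iM] := ideal_gen_ideal (fun x => x = var K a \/ x = var K b).
apply: ideal_sum => // mu /Vf; rewrite /edge_deg addn_gt0 -mul_mpolyC => H.
apply: (iM); case/orP: H => /mpolyX_decomp [nu -> _]; rewrite mulrC; apply: iM;
  by apply: ideal_genS; auto.
Qed.

Lemma edge_primeC a b f : edge_prime K a b f <-> edge_prime K b a f.
Proof. by rewrite !edge_primeE edge_vanishC. Qed.

(** Primality is the order one case of [edge_vanish_primary]. *)
Lemma edge_prime_prime a b : is_prime_ideal (edge_prime K a b).
Proof.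
split; first exact: ideal_gen_ideal.
  by rewrite edge_primeE -mpolyX0 edge_vanishX /edge_deg /expo !mnm0E.
move=> f g; rewrite !edge_primeE => Vfg.
case: (boolP (edge_vanish a b 1 g)) => [|ng]; first by right.
by left; apply: edge_vanish_primary ng.
Qed.

(** * The intersection of the powers of the edge primes, and its associated primes *)

Definition edge_symbolic n : pred R :=
  fun f => [forall a, forall b, adj a b ==> edge_vanish a b n f].

Lemma edge_symbolicP n f :
  reflect (forall a b, adj a b -> edge_vanish a b n f) (edge_symbolic n f).
Proof.
apply: (iffP forallP) => [H a b ab|H a]; first exact: (implyP (forallP (H a) b)).
by apply/forallP => b; apply/implyP/H.
Qed.

Lemma cover_idealE f : cover_ideal K G f <-> edge_symbolic 1 f.
Proof.
split=> [H|/edge_symbolicP H a b /H /edge_primeE //].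
by apply/edge_symbolicP => a b /H /edge_primeE.
Qed.

(** Call an edge bad if [f] has order below [n] there. If [p] contains both variables of a bad edge,
    it is the prime of that edge. Otherwise each bad edge has a variable outside [p], and the
    product of the [n]-th powers of these variables lies in [p], against primality. *)
Lemma associated_edge n (p : R -> Prop) f : is_prime_ideal p ->
  (forall g, p g <-> edge_symbolic n (g * f)) ->
  exists a b, adj a b /\ forall g, p g <-> edge_prime K a b g.
Proof.
move=> p_prime pE; have [[p0 pD pM] np1 _] := p_prime.
pose inp g := edge_symbolic n (g * f).
pose bad (e : G * G) := adj e.1 e.2 && ~~ edge_vanish e.1 e.2 n f.
case: (boolP [exists e, [&& bad e, inp (var K e.1) & inp (var K e.2)]]).
  case/existsP=> -[a b] /and3P [/andP [/= ab nf] /pE pa /pE pb].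
  (* For [g] outside the edge prime, the order of [g * f] at the bad edge would be that of [f],
     hence below [n]. *)
  exists a, b; split=> // g; split.
    move=> /pE /edge_symbolicP /(_ a b ab); rewrite edge_primeE.
    case: (boolP (edge_vanish a b 1 g)) => // ng; rewrite mulrC => Vfg.
    by rewrite (edge_vanish_primary Vfg ng) in nf.
  by apply: ideal_gen_min => // _ [] ->.
rewrite negb_exists => /forallP good; case: np1.
(* No bad edge has both variables in [p], so this choice always falls outside [p]. *)
pose y (e : G * G) : R := if inp (var K e.1) then var K e.2 else var K e.1.
have npy e : bad e -> ~ p (y e ^+ n).
  move=> bade; apply: prime_exp => //; have := good e; rewrite /y bade /=.
  case: ifP => [_ /= /negP H /pE //|/negP H _ /pE //].
suff: p (\prod_(e | bad e) y e ^+ n).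
  by move=> H; exfalso; apply: prime_prod H.
apply/pE/edge_symbolicP => a b ab.
have [_ _ VM] := edge_vanish_ideal a b n.
case: (boolP (edge_vanish a b n f)) => [|nf]; first exact: VM.
have bade : bad (a, b) by rewrite /bad /= ab.
(* At a bad edge its own factor of the product already supplies order [n]. *)
rewrite (bigD1 (a, b)) //= -mulrA mulrC; apply: VM.
have Vy : edge_vanish a b 1 (y (a, b)).
  by rewrite /y /=; case: ifP; rewrite (var_vanish, var_vanishr).
elim: (n) => [|k IHk]; first exact/edge_vanishP.
by rewrite exprS -add1n; apply: edge_vanishM.
Qed.

(** * Critical exponents and colon ideals *)

(** Edges are compared as sets because [adj] holds for both orderings of the exempted edge. The
    successor avoids a truncated [n - 1] and forces [n] to be positive. *)
Definition critical n a b mu : Prop :=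
  (edge_deg a b mu).+1 = n /\
  forall c d, adj c d -> [set c; d] != [set a; b] -> (n <= edge_deg c d mu)%N.

Lemma edge_deg_set2 a b c d mu : adj a b ->
  [set c; d] = [set a; b] -> edge_deg c d mu = edge_deg a b mu.
Proof.
move=> ab E; have nab : a != b by apply: contraTneq ab => ->; rewrite adj_irrefl.
have: a \in [set c; d] by rewrite E set21.
have: b \in [set c; d] by rewrite E set22.
rewrite !inE => /orP [] /eqP Eb /orP [] /eqP Ea; subst; rewrite ?eqxx // in nab *.
exact: edge_degC.
Qed.

Lemma mulX_vanish a b n k g mu :
  edge_deg a b mu = k -> edge_vanish a b (n + k) (g * 'X_[mu]) = edge_vanish a b n g.
Proof.
move=> <-; rewrite /edge_vanish (perm_all _ (msuppMX _ _)) all_map.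
by apply: eq_all => nu /=; rewrite edge_degD addnC leq_add2l.
Qed.

(** Multiplication by the monomial raises the order along [ab] by exactly [n - 1], so [g] has to
    contribute one more; along the other edges the monomial suffices. *)
Lemma critical_colon n a b mu g : adj a b -> critical n a b mu ->
  edge_prime K a b g <-> edge_symbolic n (g * 'X_[mu]).
Proof.
move=> ab [degab degcd]; rewrite edge_primeE -(mulX_vanish 1 g (erefl (edge_deg a b mu))) add1n degab.
split=> [Vab|/edge_symbolicP /(_ a b ab) //].
apply/edge_symbolicP => c d cd.
case: (eqVneq [set c; d] [set a; b]) => [E|ne].
  by apply/edge_vanishP => nu /(edge_vanishP _ _ _ _ Vab); rewrite (edge_deg_set2 _ ab E).
case: (edge_vanish_ideal c d n) => _ _; apply.
by rewrite edge_vanishX degcd.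
Qed.

(** Membership is tested monomial by monomial. A monomial of [f] that fails along some edge is
    repaired both by [x_a] and by [x_b], so that edge contains both [a] and [b]. *)
Lemma colon_critical n a b f : adj a b ->
  (forall g, edge_prime K a b g <-> edge_symbolic n (g * f)) ->
  exists2 mu, mu \in msupp f & critical n a b mu.
Proof.
move=> ab pE; have /edge_symbolicP Ha : edge_symbolic n (var K a * f).
  by apply/pE/edge_primeE/var_vanish.
have /edge_symbolicP Hb : edge_symbolic n (var K b * f).
  by apply/pE/edge_primeE/var_vanishr.
(* A variable raises the degree along [cd] by one if it belongs to an endpoint, and otherwise leaves
   it unchanged. *)
have shift x c d mu : edge_vanish c d n (var K x * f) -> mu \in msupp f ->
    (n <= (x == c) + (x == d) + edge_deg c d mu)%N.
  move=> /edge_vanishP H muf; rewrite -!expoU.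
  rewrite -/(edge_deg c d _) -edge_degD; apply: H.
  by rewrite mulrC (perm_mem (msuppMX _ _)) map_f.
have [_ np1 _] := edge_prime_prime a b.
have : ~~ edge_symbolic n f by apply/negP => H; apply/np1/pE; rewrite mul1r.
rewrite negb_forall => /existsP [c]; rewrite negb_forall => /existsP [d].
rewrite negb_imply => /andP [cd]; rewrite -has_predC => /hasP [mu muf /=].
rewrite -ltnNge => deg_lt.
have nab : a != b by apply: contraTneq ab => ->; rewrite adj_irrefl.
(* Any edge along which [mu] is deficient is [ab]; this gives the deficiency at [ab] as well as the
   bound on all other edges. *)
have key c' d' : adj c' d' -> (edge_deg c' d' mu < n)%N -> [set c'; d'] = [set a; b].
  move=> cd' lt; have a_in : a \in [set c'; d'].
    by have := shift a _ _ mu (Ha _ _ cd') muf; rewrite !inE; lia.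
  have b_in : b \in [set c'; d'].
    by have := shift b _ _ mu (Hb _ _ cd') muf; rewrite !inE; lia.
  apply/eqP; rewrite eq_sym eqEcard subUset !sub1set a_in b_in /=.
  by rewrite !cards2 nab; case: (c' != d').
have Ecd := key _ _ cd deg_lt.
exists mu => //; split.
  have := shift a _ _ mu (Ha _ _ ab) muf.
  rewrite (edge_deg_set2 _ ab Ecd) in deg_lt.
  by rewrite eqxx (negPf nab) addn0 add1n => H; apply/eqP; rewrite eqn_leq deg_lt.
move=> c' d' cd' ne; rewrite leqNgt; apply/negP => /(key _ _ cd') E.
by rewrite E eqxx in ne.
Qed.

(** * Symbolic powers of the cover ideal *)

Definition monom_of (w : G -> nat) : monom :=
  [multinom w (enum_val i) | i < #|G|].

Lemma expo_monom_of w a : expo (monom_of w) a = w a.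
Proof. by rewrite /expo mnmE enum_rankK. Qed.

Lemma mdeg_expo mu : mdeg mu = (\sum_a expo mu a)%N.
Proof.
rewrite mdegE (reindex (@enum_rank G)) //=.
by exists enum_val => i _; rewrite (enum_rankK, enum_valK).
Qed.

(* The exponent of the product of the variables outside {a, b}: it is a unit
   in the localization at <x_a, x_b>, and multiplied by x_a or x_b it lies in
   the cover ideal. *)
Definition off_edge a b : monom :=
  monom_of (fun c => c \notin [set a; b] : nat).

Lemma expo_off_edge a b c : expo (off_edge a b) c = (c \notin [set a; b]).
Proof. exact: expo_monom_of. Qed.

Lemma edge_deg_off_edge a b : edge_deg a b (off_edge a b) = 0%N.
Proof. by rewrite /edge_deg !expo_off_edge !inE !eqxx orbT. Qed.

(** An edge other than [ab] has an endpoint outside [a] and [b], where the exponent is 1. *)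
Lemma off_edge_critical a b : adj a b -> critical 1 a b (off_edge a b).
Proof.
move=> ab; split=> [|c d cd]; first by rewrite edge_deg_off_edge.
apply: contraR; rewrite -leqNgt leqn0 addn_eq0 !expo_off_edge !eqb0 !negbK.
case/andP=> cab dab; rewrite eqEcard subUset !sub1set cab dab /=.
rewrite !cards2; case: (eqVneq c d) => [E|_]; first by rewrite E adj_irrefl in cd.
by case: (a != b).
Qed.

Lemma edge_prime_associated a b : adj a b ->
  associated_prime (cover_ideal K G) (edge_prime K a b).
Proof.
move=> ab; split; first exact: edge_prime_prime.
exists 'X_[off_edge a b] => g; rewrite /colon cover_idealE.
exact: critical_colon (off_edge_critical ab).
Qed.

(** The [n] copies of the off-edge monomial are paired with [n] factors [x_a] or [x_b] of the
    monomial of [mu]; each pair multiplies into the cover ideal. *)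
Lemma off_edge_pow a b n mu : adj a b -> (n <= edge_deg a b mu)%N ->
  ideal_pow (cover_ideal K G) n ('X_[off_edge a b] ^+ n * 'X_[mu]).
Proof.
move=> ab; have nab : a != b by apply: contraTneq ab => ->; rewrite adj_irrefl.
have nba : b != a by rewrite eq_sym.
elim: n mu => [|n IHn] mu; first move=> _.
  rewrite expr0 mulrC; case: (ideal_gen_ideal (fun x : R => exists f : 'I_0 -> R,
    (forall i, cover_ideal K G (f i)) /\ x = \prod_(i < 0) f i)) => _ _; apply.
  by apply: ideal_genS; exists (fun _ => 0); split=> [[]//|]; rewrite big_ord0.
have step c nu : edge_prime K a b (var K c) -> (n <= edge_deg a b nu)%N ->
    ideal_pow (cover_ideal K G) n.+1
      ('X_[off_edge a b] ^+ n.+1 * (var K c * 'X_[nu])).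
  move=> pc nun; rewrite exprSr -mulrA [_ * (_ * 'X_[nu])]mulrA mulrCA.
  apply: ideal_powS; last exact: IHn.
  by rewrite mulrC; apply/cover_idealE/(critical_colon _ ab (off_edge_critical ab)).
move=> deg; have: (0 < edge_deg a b mu)%N by apply: leq_ltn_trans deg.
rewrite addn_gt0 => /orP [] /mpolyX_decomp [nu -> muE]; apply: step.
- exact/edge_primeE/var_vanish.
- by move: deg; rewrite muE edge_degD {1}/edge_deg !expoU eqxx (negPf nab).
- exact/edge_primeE/var_vanishr.
- by move: deg; rewrite muE edge_degD {1}/edge_deg !expoU eqxx (negPf nba).
Qed.

(** The associated primes of J are the edge primes, and J^n localized at one of them contracts to
    the [n]-th power of that prime. *)
Lemma symbolic_powerE n f :
  symbolic_power (cover_ideal K G) n f <-> edge_symbolic n f.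
Proof.
have pow_ideal : is_ideal (ideal_pow (cover_ideal K G) n) by apply: ideal_gen_ideal.
split=> [Sf|/edge_symbolicP Vf q [q_prime [h qE]]].
  apply/edge_symbolicP => a b ab.
  have := Sf _ (edge_prime_associated ab).
  move/(contractionP _ pow_ideal (edge_prime_prime a b)) => [h].
  rewrite edge_primeE => /negP nh; rewrite mulrC => Jhf.
  (* The denominator [h] is outside the edge prime and cancels; it remains that J^n lies in the
     [n]-th power of the edge prime. *)
  apply: edge_vanish_primary nh; move: Jhf.
  apply: (ideal_gen_min (I := fun g => edge_vanish a b n g)).
    exact: edge_vanish_ideal.
  move=> _ [g [Jg ->]]; elim: (n) g Jg => [|k IHk] g Jg.
    exact/edge_vanishP.
  rewrite big_ord_recl; apply: (@edge_vanishM a b 1 k); last exact: IHk.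
  by apply/edge_primeE/Jg.
have [|a [b [ab qab]]] := @associated_edge 1 q h q_prime.
  by move=> g; rewrite qE /colon cover_idealE.
apply/(contractionP _ pow_ideal q_prime).
(* This denominator is outside [q] and multiplies every monomial of [f] into J^n. *)
exists ('X_[off_edge a b] ^+ n).
  apply: prime_exp => //; rewrite qab edge_primeE edge_vanishX.
  by rewrite edge_deg_off_edge.
have [_ _ pM] := pow_ideal.
rewrite [f]mpolyE mulr_sumr; apply: ideal_sum => // mu muf.
rewrite -mul_mpolyC mulrCA; apply: pM; apply: off_edge_pow => //.
exact: (edge_vanishP _ _ _ _ (Vf a b ab)).
Qed.

(** * Local v-numbers as least degrees of critical exponents *)

Lemma local_v_number_critical n a b u mu : adj a b -> critical n a b mu ->
  mdeg mu = u -> (forall nu, critical n a b nu -> u <= mdeg nu)%N ->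
  is_local_v_number (symbolic_power (cover_ideal K G) n) (edge_prime K a b) u.
Proof.
move=> ab cmu degmu umin.
have colonX g : edge_prime K a b g <->
    colon (symbolic_power (cover_ideal K G) n) 'X_[mu] g.
  by rewrite /colon symbolic_powerE; apply: critical_colon.
split; first by split; [apply: edge_prime_prime | exists 'X_[mu]].
split; first by exists 'X_[mu] => //; rewrite dhomogX; apply/eqP.
move=> k [f /dhomogP fk pE].
have [|nu nuf cnu] := @colon_critical n a b f ab.
  by move=> g; rewrite pE /colon symbolic_powerE.
by rewrite -(fk _ nuf); apply: umin.
Qed.

Lemma associated_symbolic_power n p :
  associated_prime (symbolic_power (cover_ideal K G) n) p ->
  exists a b, adj a b /\ forall g, p g <-> edge_prime K a b g.
Proof.
move=> [p_prime [f pE]]; apply: (@associated_edge n _ f) => // g.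
by rewrite pE /colon symbolic_powerE.
Qed.

End EdgeOrder.

(** Ideals are predicates, so a prime is identified with an edge prime only up to pointwise
    equivalence; uniqueness is needed in that form. *)
Lemma is_local_v_number_uniq (K : fieldType) N (I p q : {mpoly K[N]} -> Prop) u v :
  (forall g, p g <-> q g) ->
  is_local_v_number I p u -> is_local_v_number I q v -> u = v.
Proof.
move=> pq [_ [[f fu fE] minu]] [_ [[g gv gE] minv]]; apply/eqP; rewrite eqn_leq.
apply/andP; split; [apply: minu; exists g | apply: minv; exists f] => // h.
  by rewrite pq gE.
by rewrite -pq fE.
Qed.

(** * Edges and blocks of the graph *)

Section Degrees.
Variables m s : nat.
Local Notation G := (Kms m s).
Local Notation monom := 'X_{1..#|G|}.
Implicit Types (mu : monom) (i j : 'I_m) (l : 'I_s).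

Lemma Kms_edge_ind (Pr : G -> G -> Prop) :
  (forall c d, Pr c d -> Pr d c) ->
  (forall i j, i < j -> Pr (core s i) (core s j)) ->
  (forall j l, Pr (core s j) (pendant j l)) ->
  forall c d, adj c d -> Pr c d.
Proof.
move=> PrC Prc Prp [i|[i l]] [j|[j k]] //=.
- by rewrite neq_ltn => /orP [/Prc|/Prc /PrC].
- by move=> /eqP ->; apply: Prp.
- by move=> /eqP ->; apply/PrC/Prp.
Qed.

Lemma criticalP n (a b : G) mu :
  (edge_deg a b mu).+1 = n ->
  (forall i j, i < j -> [set core s i; core s j] != [set a; b] ->
    n <= edge_deg (core s i) (core s j) mu) ->
  (forall j l, [set core s j; pendant j l] != [set a; b] ->
    n <= edge_deg (core s j) (pendant j l) mu) ->
  critical n a b mu.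
Proof.
move=> degab degc degp; split=> //.
by apply: Kms_edge_ind => // c d; rewrite edge_degC setUC.
Qed.

(** The blocks partition the vertices, and each pendant edge stays inside one block. *)
Definition block mu j : nat :=
  expo mu (core s j) + \sum_l expo mu (pendant j l).

Lemma mdeg_block mu : mdeg mu = \sum_j block mu j.
Proof.
rewrite mdeg_expo big_sumType big_split /=; congr (_ + _).
by rewrite pair_big; apply: eq_bigr => -[].
Qed.

Lemma leq_block n mu j (l : 'I_s) :
  n <= edge_deg (core s j) (pendant j l) mu -> n <= block mu j.
Proof.
move=> /leq_trans; apply; rewrite leq_add2l (bigD1 l) //=; exact: leq_addr.
Qed.

Lemma sum_constD1 q (j : 'I_q) c : \sum_(i | i != j) c = (q - 1) * c.
Proof. by rewrite sum_nat_const (cardC1 j) card_ord subn1. Qed.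

Lemma sum_constD2 q (i j : 'I_q) c : i != j ->
  \sum_(k | (k != i) && (k != j)) c = (q - 2) * c.
Proof.
move=> ij; have := sum_constD1 i c.
rewrite (bigD1 j) 1?eq_sym //= mulnBl mul1n => H.
by rewrite mulnBl mul2n -addnn subnDA -H addKn.
Qed.

Lemma core_pendant_neq (j i : 'I_m) (l k : 'I_s) : (i != j) || (k != l) ->
  [set core s i; pendant i k] != [set core s j; pendant j l].
Proof.
apply: contraL => /eqP E.
have: pendant i k \in [set core s j; pendant j l] by rewrite -E set22.
by rewrite !inE /= => /eqP [-> ->]; rewrite !eqxx.
Qed.

Lemma core_pendant_core_neq (i j k : 'I_m) (l : 'I_s) :
  [set core s i; core s k] != [set core s j; pendant j l].
Proof.
apply/eqP => E.
by have := set22 (core s j) (pendant j l); rewrite -E !inE.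
Qed.

(** * Least degree for a pendant edge *)

(** A critical exponent of least degree: [n - 1] at vertex [j] forces 1 at its pendants other than
    [jl], and [n] at each other core vertex covers all remaining edges. *)
Definition pendant_weight n j l (a : G) : nat :=
  match a with
  | inl i => if i == j then n.-1 else n
  | inr (i, k) => (i == j) && (k != l)
  end.

Lemma pendant_weight_critical n j l : 0 < n ->
  critical n (core s j) (pendant j l) (monom_of (pendant_weight n j l)).
Proof.
move=> n_gt0; apply: criticalP; rewrite /edge_deg.
- by rewrite !expo_monom_of /= !eqxx addn0 prednK.
- move=> i k ik _; rewrite !expo_monom_of /=.
  by case: eqP => Ei; case: eqP => Ek; move: ik; rewrite ?Ei ?Ek; lia.
- move=> i k ne; rewrite !expo_monom_of /=; case: eqP => [E|_]; last exact: leq_addr.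
  case: eqP => [F|_] /=; last by rewrite addn1 prednK.
  by rewrite E F eqxx in ne.
Qed.

Lemma pendant_weight_deg n j l : 0 < n ->
  mdeg (monom_of (pendant_weight n j l)) = m * n + s - 2.
Proof.
move=> n_gt0; rewrite mdeg_block (bigD1 j) //=.
rewrite (eq_bigr (fun _ => n)) => [|i /negPf nij]; last first.
  rewrite /block expo_monom_of /= nij big1 ?addn0 // => k _.
  by rewrite expo_monom_of /= nij.
rewrite sum_constD1 /block expo_monom_of /= eqxx.
rewrite (bigD1 l) //= expo_monom_of /= !eqxx add0n.
rewrite (eq_bigr (fun _ => 1)) => [|k kl]; last by rewrite expo_monom_of /= eqxx kl.
rewrite sum_constD1 muln1 mulnBl mul1n.
have := ltn_ord j; have := ltn_ord l; nia.
Qed.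

Lemma pendant_critical_deg n j l mu :
  critical n (core s j) (pendant j l) mu -> m * n + s - 2 <= mdeg mu.
Proof.
move=> [degjl degcd]; rewrite mdeg_block (bigD1 j) //=.
(* Each block other than that of [j] contains a pendant edge, of degree at least [n]. *)
have rest : (m - 1) * n <= \sum_(i | i != j) block mu i.
  rewrite -(sum_constD1 j); apply: leq_sum => i ij.
  apply: (@leq_block _ _ _ l); apply: degcd; first exact: eqxx.
  by apply: core_pendant_neq; rewrite ij.
suff : n.-1 + (s - 1) <= block mu j.
  have : n <= m * n by rewrite leq_pmull // (leq_ltn_trans _ (ltn_ord j)).
  move=> nm /leq_add /(_ rest); apply: leq_trans.
  by rewrite mulnBl mul1n; have := ltn_ord l; lia.
(* The edge [(j,jl)] accounts for [n - 1]. As the exponent at [j] is at most [n - 1], each of the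
   other [s - 1] pendants at [j] carries at least 1. *)
rewrite /block (bigD1 l) //= addnA -/(edge_deg _ _ mu) -degjl leq_add2l.
rewrite -[X in X <= _]muln1 -(sum_constD1 l).
apply: leq_sum => k kl; have := degcd (core s j) (pendant j k) (eqxx _).
rewrite core_pendant_neq ?kl ?orbT // => /(_ isT).
by move: degjl; rewrite /edge_deg; lia.
Qed.

(** * Least degree for an edge of the complete graph *)

(** Any split of [n - 1] between [i] and [j], with their pendants filled up to [n], gives the same
    degree; here all of it sits at [i]. *)
Definition core_weight n i j (a : G) : nat :=
  match a with
  | inl k => if k == i then n.-1 else if k == j then 0 else n
  | inr (k, _) => if k == i then 1 else if k == j then n else 0
  end.

Lemma core_weight_critical n i j : 0 < n -> i != j ->
  critical n (core s i) (core s j) (monom_of (core_weight n i j)).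
Proof.
move=> n_gt0 ij; have ji : (j == i) = false by rewrite eq_sym; apply: negPf.
apply: criticalP; rewrite /edge_deg.
- by rewrite !expo_monom_of /= !eqxx ji addn0 prednK.
- move=> k h kh ne; rewrite !expo_monom_of /=.
  have kh' : (k == h) = false by apply: negbTE; rewrite neq_ltn kh.
  case: (eqVneq k i) ne kh' => [->|ki]; case: (eqVneq h i) => [->|hi];
    rewrite ?eqxx //.
  + case: (eqVneq h j) => [->|hj]; first by rewrite eqxx.
    by rewrite leq_addl.
  + case: (eqVneq k j) => [->|kj]; first by rewrite setUC eqxx.
    by rewrite leq_addr.
  + case: (eqVneq k j) => [->|kj]; last by rewrite leq_addr.
    by case: (eqVneq h j) => [->|hj]; rewrite ?eqxx.
- move=> k l _; rewrite !expo_monom_of /=.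
  by case: ifP => _; [rewrite addn1 prednK | case: ifP => _; lia].
Qed.

Lemma core_weight_deg n i j : 0 < n -> i != j -> 0 < s ->
  mdeg (monom_of (core_weight n i j)) = (m + s - 1) * n + s - 1.
Proof.
move=> n_gt0 ij s_gt0; have ji : (j == i) = false by rewrite eq_sym; apply: negPf.
rewrite mdeg_block (bigD1 i) //= (bigD1 j) ?ji //=.
rewrite (eq_bigr (fun _ => n)) => [|k /andP [/negPf ki /negPf kj]]; last first.
  rewrite /block expo_monom_of /= ki kj big1 ?addn0 // => l _.
  by rewrite expo_monom_of /= ki kj.
rewrite sum_constD2 // /block !expo_monom_of /= !eqxx ji.
rewrite (eq_bigr (fun _ => 1)) => [|l _]; last by rewrite expo_monom_of /= eqxx.
rewrite [X in _ + (_ + X + _)](eq_bigr (fun _ => n)) => [|l _]; last first.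
  by rewrite expo_monom_of /= ji eqxx.
rewrite !sum_nat_const card_ord.
have : 1 < m by move: (ltn_ord i) (ltn_ord j) ij; rewrite -val_eqE /=; lia.
nia.
Qed.

Lemma core_critical_deg n i j mu : i != j -> 0 < s ->
  critical n (core s i) (core s j) mu -> (m + s - 1) * n + s - 1 <= mdeg mu.
Proof.
move=> ij s_gt0 [degij degcd]; have ji : j != i by rewrite eq_sym.
have degp k l : n <= edge_deg (core s k) (pendant k l) mu.
  by apply: degcd; [exact: eqxx | rewrite eq_sym core_pendant_core_neq].
have rest : (m - 2) * n <= \sum_(k | (k != i) && (k != j)) block mu k.
  rewrite -(sum_constD2 _ ij); apply: leq_sum => k _.
  exact: leq_block (degp k (Ordinal s_gt0)).
(* All [s] pendants at [k] must make up for what the core vertex lacks to reach [n]. *)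
have blockP k : expo mu (core s k) + s * (n - expo mu (core s k)) <= block mu k.
  rewrite leq_add2l -{1}(card_ord s) -sum_nat_const; apply: leq_sum => l _.
  by rewrite leq_subLR; apply: degp.
rewrite mdeg_block (bigD1 i) //= (bigD1 j) //=.
apply: leq_trans (leq_add (blockP i) (leq_add (blockP j) rest)).
move: degij; rewrite /edge_deg.
have : 1 < m by move: (ltn_ord i) (ltn_ord j) ij; rewrite -val_eqE /=; lia.
set x := expo mu (core s i); set y := expo mu (core s j).
(* Since [x + y] is [n - 1], neither difference is truncated, and they add up to [n + 1]. *)
move=> m_gt1 nE; have sE : s * (n - x) + s * (n - y) = s * n + s.
  by rewrite -mulnDr -mulnSr; congr (s * _); lia.
have : 2 * n <= m * n by rewrite leq_mul2r m_gt1 orbT.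
by rewrite !mulnBl mulnDl mul1n; lia.
Qed.

End Degrees.

(** * The local v-numbers and their minimum *)

Theorem theorem4p9 (K : fieldType) (m s : nat) (hm : 2 <= m) (hs : 1 <= s)
    (n : nat) (hn : 1 <= n) :
  let J := cover_ideal K (Kms m s) in
  let P (j : 'I_m) (l : 'I_s) := edge_prime K (core s j) (pendant j l) in
  let Q (i j : 'I_m) := edge_prime K (core s i) (core s j) in
  [/\ forall (j : 'I_m) (l : 'I_s),
        is_local_v_number (symbolic_power J n) (P j l) (m * n + s - 2),
      forall i j : 'I_m, i < j ->
        is_local_v_number (symbolic_power J n) (Q i j)
          ((m + s - 1) * n + s - 1)
    & is_v_number (symbolic_power J n) (m * n + s - 2)].
Proof.
move=> J P Q.
have locP j l : is_local_v_number (symbolic_power J n) (P j l) (m * n + s - 2).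
  apply: (local_v_number_critical K _ (pendant_weight_critical j l hn)).
  - exact: eqxx.
  - exact: pendant_weight_deg.
  - exact: pendant_critical_deg.
have locQ (i j : 'I_m) : i < j ->
    is_local_v_number (symbolic_power J n) (Q i j) ((m + s - 1) * n + s - 1).
  move=> ij; have nij : i != j by rewrite neq_ltn ij.
  apply: (local_v_number_critical K _ (core_weight_critical s hn nij)) => //.
  - exact: core_weight_deg.
  - by move=> nu; apply: core_critical_deg.
split=> //; split.
  exists (P (Ordinal (ltnW hm)) (Ordinal hs)); exact: locP.
(* Any competing prime is an edge prime, so its local v-number is one of the two values found. *)
move=> u [p pu]; have [c [d [cd pE]]] := associated_symbolic_power (proj1 pu).
move: c d cd p pu pE.
apply: Kms_edge_ind.
- by move=> c d IH p pu pE; apply: (IH p pu) => g; rewrite pE; apply: edge_primeC.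
- move=> i j ij p pu pE; rewrite (is_local_v_number_uniq pE pu (locQ i j ij)).
  (* From [s >= 1] follows [m + s - 1 >= m], so the value at a core edge is no smaller. *)
  nia.
- by move=> j l p pu pE; rewrite (is_local_v_number_uniq pE pu (locP j l)).
Qed.
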